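(* Let $\mathbb{F}$ be a field of characteristic $0$, let $n\in\mathbb{N}$, $\varkappa=(\varkappa_1,\ldots,\varkappa_n)\in\mathbb{N}^n$ (all $\varkappa_j\ge1$), $N=|\varkappa|=\varkappa_1+\cdots+\varkappa_n$, and $m\in\mathbb{N}_0$. Then the following identity holds in $\mathbb{F}(y_1,\ldots,y_n)$: \[ \operatorname{h}_m(y^{[\varkappa]})=\sum_{s=1}^{n}\sum_{r=1}^{\varkappa_s} B_{y,\varkappa,s,r}\binom{m+N-1}{r-1}\,y_s^{m+N-r}. \] As a consequence, the same identity holds when $y_1,\ldots,y_n$ are pairwise different elements of $\mathbb{F}$.
   Context: For variables $x_1,\ldots,x_N$ and $m\in\mathbb{N}_0$, $\operatorname{h}_m(x_1,\ldots,x_N)=\sum_{k\in\mathbb{N}_0^N,\ k_1+\cdots+k_N=m} x_1^{k_1}\cdots x_N^{k_N}$ (so $\operatorname{h}_0=1$). For $\varkappa\in\mathbb{N}_0^n$, $y^{[\varkappa]}$ denotes the list consisting of $y_1$ repeated $\varkappa_1$ times, then $y_2$ repeated $\varkappa_2$ times, ..., then $y_n$ repeated $\varkappa_n$ times. For $s\in\{1,\ldots,n\}$ and $r\in\{1,\ldots,\varkappa_s\}$, define \[ B_{y,\varkappa,s,r}=(-1)^{|\varkappa|-\varkappa_s}\Biggl(\prod_{d\in\{1,\ldots,n\}\setminus\{s\}}\frac{1}{(y_d-y_s)^{\varkappa_d}}\Biggr)\operatorname{h}_{\varkappa_s-r}(z), \] where $z$ is the list of length $|\varkappa|-\varkappa_s$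 obtained by listing, for $d=1,\ldots,n$ with $d\ne s$ in increasing order, the element $1/(y_d-y_s)$ repeated $\varkappa_d$ times. *)

(* Defs.v *)
From HB Require Import structures.
From mathcomp Require Import all_boot all_order all_algebra.
From mathcomp Require Export fraction.
From mathcomp Require Export mpoly.

Set Implicit Arguments.
Unset Strict Implicit.
Unset Printing Implicit Defensive.

Import GRing.Theory.
Local Open Scope ring_scope.

(* The multi-indices of N_0^N of weight m have all their entries at most m,
   so they are the functions 'I_N -> 'I_m.+1 of weight m. *)
Definition hsym (R : comNzRingType) (m : nat) (x : seq R) : R :=
  \sum_(k : {ffun 'I_(size x) -> 'I_m.+1} | (\sum_i (k i : nat) == m)%N)
    \prod_(i < size x) x`_i ^+ k i.

Definition weight (n : nat) (kappa : 'I_n -> nat) : nat := (\sum_i kappa i)%N.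

(* The list y^[kappa]; [enum 'I_n] is increasing. *)
Definition rep_list (T : Type) (n : nat) (y : 'I_n -> T) (kappa : 'I_n -> nat)
  : seq T :=
  flatten [seq nseq (kappa d) (y d) | d <- enum 'I_n].

Definition inv_diff_list (K : fieldType) (n : nat) (y : 'I_n -> K)
    (kappa : 'I_n -> nat) (s : 'I_n) : seq K :=
  flatten [seq nseq (kappa d) (y d - y s)^-1 | d <- enum 'I_n & d != s].

Definition Bcoef (K : fieldType) (n : nat) (y : 'I_n -> K)
    (kappa : 'I_n -> nat) (s : 'I_n) (r : nat) : K :=
  (-1) ^+ (weight kappa - kappa s)
  * (\prod_(d < n | d != s) ((y d - y s) ^+ kappa d)^-1)
  * hsym (kappa s - r) (inv_diff_list y kappa s).

(* The indeterminate y_i of the field of rational functions F(y_1, ..., y_n). *)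
Definition ratvar (F : fieldType) (n : nat) (i : 'I_n)
  : {fraction {mpoly F[n]}} :=
  FracField.tofrac ('X_i : {mpoly F[n]}).

(* Main.v *)
Require Import Defs.
From HB Require Import structures.
From mathcomp Require Import all_boot all_order all_algebra.
From mathcomp Require Import fraction mpoly.
From mathcomp Require Import zify ring.

(* With M = m + N - 1, the inner sum over r is the residue at y_s of
   t^M / prod_d (t - y_d)^(kappa_d), and h_m(y^[kappa]) is a divided difference
   of t^M. For a <> b, both sides G(kappa) of the identity obey
     (y_a - y_b) G(kappa) = G(kappa - e_b) - G(kappa - e_a)   (M fixed):
   for the residues this comes from y_a - y_b = (t - y_b) - (t - y_a). Induction
   on N reduces to a kappa supported at one index s, where both sides are
   C(m + N - 1, N - 1) y_s^m. The indeterminates are pairwise different elements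
   of the field F(y_1, ..., y_n), so both claims are the same statement. *)

Set Implicit Arguments.
Unset Strict Implicit.
Unset Printing Implicit Defensive.

Import GRing.Theory.
Local Open Scope ring_scope.

(** * Complete homogeneous polynomials via generating functions *)

Section CompleteHomogeneous.
Variable R : comNzRingType.
Implicit Types (m M : nat) (x : R) (s : seq R).

(** The geometric series of 1 / (1 - x X) cut at degree [M]: coefficients below [M] are exact, so
    polynomials can replace power series. *)
Let geom M x : {poly R} := \poly_(i < M) x ^+ i.

Let coef_prod_geom m M M' s : (m < M)%N -> (m < M')%N ->
  (\prod_(x <- s) geom M x)`_m = (\prod_(x <- s) geom M' x)`_m.
Proof.
elim: s m => [|x s IHs] m ltmM ltmM'; first by rewrite !big_nil.
rewrite !big_cons !coefM; apply: eq_bigr => i _.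
have lti := ltn_ord i.
by rewrite !coef_poly !ifT ?(IHs (m - i)%N) //; lia.
Qed.

(** Expanding the product of sums indexes its terms by functions into ['I_m.+1], as in [hsym].
    Symmetry and the recursions are then read off products. *)
Let hsym_coef m s : hsym m s = (\prod_(x <- s) geom m.+1 x)`_m.
Proof.
rewrite (big_nth 0) big_mkord.
under [in RHS]eq_bigr do rewrite /geom poly_def.
rewrite bigA_distr_bigA /= coef_sum /hsym big_mkcond /=.
apply: eq_bigr => k _.
rewrite scaler_prod prodrXr coefZ coefXn eq_sym.
by case: eqP => _; rewrite ?mulr1 ?mulr0.
Qed.

Lemma perm_hsym m s s' : perm_eq s s' -> hsym m s = hsym m s'.
Proof. by move=> /(perm_big _) eq_ss'; rewrite !hsym_coef eq_ss'. Qed.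

Lemma hsym_nil m : hsym m ([::] : seq R) = (m == 0)%:R.
Proof. by rewrite hsym_coef big_nil coef1. Qed.

Lemma hsym_cons m x s :
  hsym m (x :: s) = \sum_(i < m.+1) x ^+ i * hsym (m - i) s.
Proof.
rewrite hsym_coef big_cons coefM; apply: eq_bigr => i _.
have lti := ltn_ord i.
rewrite coef_poly lti hsym_coef; congr (_ * _).
by apply: coef_prod_geom; lia.
Qed.

Lemma hsym0 s : hsym 0 s = 1.
Proof.
elim: s => [|x s IHs]; first by rewrite hsym_nil.
by rewrite hsym_cons big_ord1 IHs mulr1.
Qed.

(** The monomials are split by whether [x] occurs in them. *)
Lemma hsymS_cons m x s : hsym m.+1 (x :: s) = hsym m.+1 s + x * hsym m (x :: s).
Proof.
rewrite !hsym_cons big_ord_recl mul1r; congr (_ + _).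
by rewrite mulr_sumr; apply: eq_bigr => i _; rewrite exprS mulrA.
Qed.

(** Under double induction, [hsymS_cons] becomes Pascal's rule. *)
Lemma hsym_nseq m k x : hsym m (nseq k.+1 x) = 'C(m + k, k)%:R * x ^+ m.
Proof.
elim: k m => [|k IHk] m; elim: m => [|m IHm].
- by rewrite hsym0 mulr1.
- by rewrite hsymS_cons hsym_nil IHm !bin0 exprS !mul1r add0r.
- by rewrite hsym0 mulr1 binn.
rewrite [nseq _ _]/= hsymS_cons -/(nseq k.+1 x) IHk -/(nseq k.+2 x) IHm.
by rewrite addSnnS [in RHS]addSn [in RHS]binS natrD exprS; ring.
Qed.

End CompleteHomogeneous.

(** * Lowering one multiplicity *)

Definition decr n (kappa : 'I_n -> nat) (b : 'I_n) : 'I_n -> nat :=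
  fun d => (kappa d - (d == b))%N.

Lemma weight_decr n (kappa : 'I_n -> nat) b :
  (0 < kappa b)%N -> weight kappa = (weight (decr kappa b)).+1.
Proof.
move=> kb; rewrite /weight (bigD1 b) //= [in RHS](bigD1 b) //= /decr eqxx.
under [in RHS]eq_bigr => d /negPf -> do rewrite subn0.
by rewrite subn1 -addSn prednK.
Qed.

Section MultisetDecrement.
Variables (T : eqType) (n : nat) (f : 'I_n -> T) (kappa : 'I_n -> nat).
Variable b : 'I_n.
Implicit Type l : seq 'I_n.

(** A general index list and a general [f] cover both [rep_list] and [inv_diff_list], whose index
    list omits [s]. *)
Let rep l (k : 'I_n -> nat) := flatten [seq nseq (k d) (f d) | d <- l].

Lemma rep_decr_notin l : b \notin l -> rep l (decr kappa b) = rep l kappa.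
Proof.
move=> bl; congr flatten; apply/eq_in_map => d dl.
by rewrite /decr (negPf (memPn bl d dl)) subn0.
Qed.

Lemma perm_rep_decr l : uniq l -> b \in l -> (0 < kappa b)%N ->
  perm_eq (rep l kappa) (f b :: rep l (decr kappa b)).
Proof.
move=> ul bl kb; have lP := perm_to_rem bl.
have bNl : b \notin rem b l by rewrite mem_rem_uniq // inE eqxx.
have repP k : perm_eq (rep l k) (rep (b :: rem b l) k).
  exact/perm_flatten/perm_map.
apply: (perm_trans (repP _)); rewrite perm_sym.
apply: (@perm_trans _ (f b :: rep (b :: rem b l) (decr kappa b))).
  by rewrite perm_cons; apply: repP.
rewrite /rep /= -!/(rep _ _) rep_decr_notin // /decr eqxx subn1.
by case: (kappa b) kb.
Qed.

End MultisetDecrement.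

(** * Residues and their recursion *)

Section PartialFractions.
Variables (K : fieldType) (n : nat) (y : 'I_n -> K).
Hypothesis y_inj : injective y.
Implicit Types (kappa : 'I_n -> nat) (a b s : 'I_n).

(* The coefficient of [(X - y s) ^+ j] in the Taylor expansion at [y s] of
   [\prod_(d != s) (X - y d) ^- kappa d]. *)
Let taylor kappa s j : K :=
  (\prod_(d < n | d != s) (y s - y d) ^- kappa d)
  * hsym j (inv_diff_list y kappa s).

(** The sign supplies one -1 per factor, turning each [y d - y s] into [y s - y d]. *)
Let BcoefE kappa s r : Bcoef y kappa s r = taylor kappa s (kappa s - r).
Proof.
rewrite /Bcoef /taylor; congr (_ * _).
have -> : (weight kappa - kappa s = \sum_(d < n | d != s) kappa d)%N.
  by rewrite /weight (bigD1 s) //= addKn.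
rewrite -prodrXr -big_split /=; apply: eq_bigr => d _.
by rewrite -exprVn -exprMn mulN1r -invrN opprB exprVn.
Qed.

Let y_neq a b : a != b -> y a - y b != 0.
Proof. by move=> ab; rewrite subr_eq0 (inj_eq y_inj). Qed.

Lemma perm_rep_list kappa b : (0 < kappa b)%N ->
  perm_eq (rep_list y kappa) (y b :: rep_list y (decr kappa b)).
Proof. by move=> kb; apply: perm_rep_decr; rewrite ?enum_uniq ?mem_enum. Qed.

Lemma perm_inv_diff_list kappa s b : b != s -> (0 < kappa b)%N ->
  perm_eq (inv_diff_list y kappa s)
          ((y b - y s)^-1 :: inv_diff_list y (decr kappa b) s).
Proof.
move=> bs kb; apply: (perm_rep_decr (fun d => (y d - y s)^-1)) => //.
  by rewrite filter_uniq ?enum_uniq.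
by rewrite mem_filter bs mem_enum.
Qed.

Let taylor_decr kappa s j : taylor (decr kappa s) s j = taylor kappa s j.
Proof.
rewrite /taylor; congr (_ * hsym _ _).
  by apply: eq_bigr => d /negPf ds; rewrite /decr ds subn0.
by apply: (rep_decr_notin (fun d => (y d - y s)^-1)); rewrite mem_filter eqxx.
Qed.

Let prod_decr kappa s b : b != s -> (0 < kappa b)%N ->
  \prod_(d < n | d != s) (y s - y d) ^- decr kappa b d =
  (y s - y b) * \prod_(d < n | d != s) (y s - y d) ^- kappa d.
Proof.
move=> bs kb; rewrite (bigD1 b) //= [in RHS](bigD1 b) //= mulrA; congr (_ * _).
  rewrite /decr eqxx subn1 -{2}(prednK kb) exprS invfM mulVKf // y_neq //.
  by rewrite eq_sym.
by apply: eq_bigr => d /andP[_ /negPf db]; rewrite /decr db subn0.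
Qed.

(* Multiplying the function expanded by [X - y b = (y s - y b) + (X - y s)]
   removes one factor. *)
Let taylor0 kappa s b : b != s -> (0 < kappa b)%N ->
  (y s - y b) * taylor kappa s 0 = taylor (decr kappa b) s 0.
Proof. by move=> bs kb; rewrite /taylor !hsym0 !mulr1 prod_decr. Qed.

Let taylorS kappa s b j : b != s -> (0 < kappa b)%N ->
  (y s - y b) * taylor kappa s j.+1 =
  taylor (decr kappa b) s j.+1 - taylor kappa s j.
Proof.
move=> bs kb; rewrite /taylor prod_decr //
  !(perm_hsym _ (perm_inv_diff_list bs kb)).
have yne := y_neq bs.
rewrite hsymS_cons.
set P := \prod_(_ < n | _) _; set h := hsym _ _; set h' := hsym _ _.
by field.
Qed.

(** For r >= 1, the coefficient of (X - y s)^(r - 1) in the expansion of X^M at [y s]. *)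
Let term M s r : K := 'C(M, r - 1)%:R * y s ^+ (M.+1 - r).

(* The residue at [y s] of [X ^+ M / \prod_d (X - y d) ^+ kappa d]. *)
Let residue kappa M s : K :=
  \sum_(1 <= r < (kappa s).+1) taylor kappa s (kappa s - r) * term M s r.

Let residue_decr_neq kappa M s b : b != s ->
  residue (decr kappa b) M s =
  \sum_(1 <= r < (kappa s).+1)
    taylor (decr kappa b) s (kappa s - r) * term M s r.
Proof.
rewrite /residue eq_sym => /negPf bs.
by have -> : decr kappa b s = kappa s by rewrite /decr bs subn0.
Qed.

Let residue_neq kappa M s a b :
    a != s -> b != s -> (0 < kappa a)%N -> (0 < kappa b)%N ->
  (y a - y b) * residue kappa M s =
  residue (decr kappa b) M s - residue (decr kappa a) M s.
Proof.
move=> as' bs ka kb; rewrite !residue_decr_neq // /residue mulr_sumr -sumrB.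
apply: eq_bigr => r _; rewrite mulrA -mulrBl; congr (_ * _).
have -> : y a - y b = (y s - y b) - (y s - y a) by ring.
(* The constant coefficient has no lower one to subtract; otherwise [taylor kappa s j] occurs twice
   and cancels. *)
rewrite mulrBl; case: (kappa s - r)%N => [|j]; first by rewrite !taylor0.
by rewrite !(taylorS j) //; ring.
Qed.

(** Lowering [kappa a] keeps the Taylor coefficients at [y a] but shortens the sum by one: the term
    r = [kappa a] is matched by [taylor0], the others by [taylorS]. *)
Let residue_eq kappa M a b :
    a != b -> (0 < kappa a)%N -> (0 < kappa b)%N ->
  (y a - y b) * residue kappa M a =
  residue (decr kappa b) M a - residue (decr kappa a) M a.
Proof.
move=> ab ka kb; rewrite residue_decr_neq 1?eq_sym // /residue.
have -> : decr kappa a a = (kappa a).-1 by rewrite /decr eqxx subn1.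
rewrite prednK // mulr_sumr !big_nat_recr //= mulrA subnn taylor0 1?eq_sym //.
rewrite addrAC -sumrB; congr (_ + _).
apply: eq_big_nat => r /andP[_ ltr].
rewrite mulrA -mulrBl taylor_decr; congr (_ * _).
have -> : (kappa a - r = ((kappa a).-1 - r).+1)%N by lia.
by rewrite taylorS 1?eq_sym.
Qed.

Let residues kappa M : K := \sum_s residue kappa M s.

Let residues_decr kappa M a b :
    a != b -> (0 < kappa a)%N -> (0 < kappa b)%N ->
  (y a - y b) * residues kappa M =
  residues (decr kappa b) M - residues (decr kappa a) M.
Proof.
move=> ab ka kb; rewrite /residues mulr_sumr -sumrB; apply: eq_bigr => s _.
have [<-|as'] := eqVneq a s; first exact: residue_eq.
have [<-|bs] := eqVneq b s; last exact: residue_neq.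
by rewrite -[LHS]opprK -mulNr opprB residue_eq 1?eq_sym // opprB.
Qed.

(** With a single pole the function expanded is 1, so only r = [kappa s] contributes. *)
Let residues_single kappa M s k : (forall d, d != s -> kappa d = 0%N) ->
  kappa s = k.+1 -> residues kappa M = 'C(M, k)%:R * y s ^+ (M - k).
Proof.
move=> k0 ks; rewrite /residues (bigD1 s) //= big1 ?addr0 => [|d ds]; last first.
  by rewrite /residue k0 // big_geq.
rewrite /residue ks big_nat_recr //= subnn big_nat big1 ?add0r => [|r rk].
  rewrite /taylor hsym0 mulr1 big1 ?mul1r => [|d ds].
    by rewrite /term subn1 subSS.
  by rewrite k0 // expr0 invr1.
have [j ->] : exists j, (k.+1 - r = j.+1)%N by exists (k - r)%N; lia.
rewrite /taylor; suff -> : inv_diff_list y kappa s = [::].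
  by rewrite hsym_nil mulr0 mul0r.
rewrite /inv_diff_list; elim: (enum _) => //= d l IHl.
by case: ifP => //= ds; rewrite k0.
Qed.

Let hsym_single kappa m s k : (forall d, d != s -> kappa d = 0%N) ->
  kappa s = k.+1 -> hsym m (rep_list y kappa) = 'C(m + k, k)%:R * y s ^+ m.
Proof.
move=> k0 ks; rewrite -hsym_nseq -ks; congr hsym; rewrite /rep_list.
(* All that the list induction needs: [s] occurs exactly once. *)
have: count_mem s (enum 'I_n) = 1%N.
  by rewrite count_uniq_mem ?enum_uniq ?mem_enum.
move: (enum _) => l.
have rep0 l' : s \notin l' ->
    flatten [seq nseq (kappa d) (y d) | d <- l'] = [::].
  elim: l' => //= d l' IHl; rewrite inE negb_or => /andP[sd /IHl ->].
  by rewrite k0 // eq_sym.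
elim: l => //= d l IHl; have [-> [/count_memPn sl]|ds] := eqVneq d s.
  by rewrite rep0 ?cats0.
by rewrite k0.
Qed.

(** * Induction on the weight *)

Lemma hsym_residues kappa m : (0 < weight kappa)%N ->
  hsym m (rep_list y kappa) = residues kappa (m + weight kappa - 1).
Proof.
have [N] := ubnP (weight kappa); elim: N kappa m => // N IHN kappa m ltN k_gt0.
have /existsP[a ka] : [exists a, 0 < kappa a]%N.
  apply: contraLR k_gt0 => /existsPn k0; rewrite /weight big1 // => d _.
  by have := k0 d; lia.
have [/existsP[b /andP[ba kb]]|/existsPn k0] :=
    boolP [exists b, (b != a) && (0 < kappa b)%N].
  have wa := weight_decr ka; have wb := weight_decr kb.
  (* The weight is thus at least 2, so both lowered weights stay positive, as the induction
     hypothesis requires. *)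
  have kba : (0 < decr kappa b a)%N by rewrite /decr eq_sym (negPf ba) subn0.
  have wba := weight_decr kba.
  apply: (mulfI (y_neq ba)); rewrite residues_decr //.
  (* The exponent is kept by raising [m] while the weight drops. *)
  have -> : (m + weight kappa - 1 = m.+1 + weight (decr kappa a) - 1)%N by lia.
  rewrite -IHN; try lia.
  have -> : weight (decr kappa a) = weight (decr kappa b) by lia.
  rewrite -IHN; try lia.
  (* Splitting off [y a] or [y b] from the same polynomial and subtracting gives the recursion. *)
  have ha : hsym m.+1 (rep_list y kappa) =
      hsym m.+1 (rep_list y (decr kappa a)) + y a * hsym m (rep_list y kappa).
    by rewrite !(perm_hsym _ (perm_rep_list ka)) hsymS_cons.
  have hb : hsym m.+1 (rep_list y kappa) =
      hsym m.+1 (rep_list y (decr kappa b)) + y b * hsym m (rep_list y kappa).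
    by rewrite !(perm_hsym _ (perm_rep_list kb)) hsymS_cons.
  by apply/eqP; rewrite mulrBl subr_eq addrAC eq_sym subr_eq -ha hb addrC.
have{} k0 d : d != a -> kappa d = 0%N.
  by move=> da; have := k0 d; rewrite da; lia.
have wk : weight kappa = (kappa a).-1.+1.
  by rewrite prednK // /weight (bigD1 a) //= big1 ?addn0.
have ks : kappa a = (kappa a).-1.+1 by lia.
rewrite (hsym_single m k0 ks) (residues_single _ k0 ks) wk.
by congr ('C(_, _)%:R * y a ^+ _); lia.
Qed.

Lemma hsym_rep_list kappa m : (0 < weight kappa)%N ->
  hsym m (rep_list y kappa) =
  \sum_(s < n) \sum_(1 <= r < (kappa s).+1)
    Bcoef y kappa s r * 'C(m + weight kappa - 1, r - 1)%:R
    * y s ^+ (m + weight kappa - r).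
Proof.
move=> k_gt0; rewrite hsym_residues //; apply: eq_bigr => s _.
apply: eq_bigr => r _; rewrite BcoefE /term mulrA.
(* Positive weight gives (m + N - 1) + 1 = m + N despite truncated subtraction. *)
by congr (_ * _ ^+ (_ - r)); lia.
Qed.

End PartialFractions.

Lemma ratvar_inj (F : fieldType) n : injective (@ratvar F n).
Proof.
move=> i j /eqP; rewrite /ratvar tofrac_eq => /eqP /(congr1 (mcoeff U_(j))).
rewrite !mcoeffXU eqxx; case: eqVneq => // _ /eqP.
by rewrite eq_sym oner_eq0.
Qed.

Theorem theorem9p5 (F : fieldType) (charF0 : [pchar F] =i pred0)
    (n : nat) (n_gt0 : (0 < n)%N)
    (kappa : 'I_n -> nat) (kappa_gt0 : forall j, (0 < kappa j)%N) (m : nat) :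
  let N := weight kappa in
  (let y := ratvar F (n := n) in
   hsym m (rep_list y kappa) =
     \sum_(s < n) \sum_(1 <= r < (kappa s).+1)
       Bcoef y kappa s r * 'C(m + N - 1, r - 1)%:R * y s ^+ (m + N - r))
  /\
  (forall y : 'I_n -> F, injective y ->
   hsym m (rep_list y kappa) =
     \sum_(s < n) \sum_(1 <= r < (kappa s).+1)
       Bcoef y kappa s r * 'C(m + N - 1, r - 1)%:R * y s ^+ (m + N - r)).
Proof.
move=> N; have N_gt0 : (0 < weight kappa)%N.
  by rewrite /weight (bigD1 (Ordinal n_gt0)) //= ltn_addr.
by split=> [|y y_inj]; apply: hsym_rep_list => //; apply: ratvar_inj.
Qed.
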